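(* Let $(\mathfrak h,\mathfrak g,\mathfrak k)$ be a Manin triple of Lie superalgebras over a field $\mathbb K$ of characteristic $2$ with $\dim(\mathfrak h)>1$. If $(\mathfrak z_s(\mathfrak h)\cap\mathfrak g)_{\bar 0}\neq 0$ or $(\mathfrak z_s(\mathfrak h)\cap\mathfrak k)_{\bar 0}\neq 0$, then the Manin triple $(\mathfrak h,\mathfrak g,\mathfrak k)$ is a $\mathscr D_{\bar 0}$-double extension of a Manin triple $(\mathfrak c,\mathfrak a,\mathfrak b)$.
   Context: All spaces are finite-dimensional. A Lie superalgebra in characteristic $2$ is a superspace $\mathfrak g=\mathfrak g_{\bar 0}\oplus\mathfrak g_{\bar 1}$ such that $\mathfrak g_{\bar 0}$ is a Lie algebra, $\mathfrak g_{\bar 1}$ is a $\mathfrak g_{\bar 0}$-module made two-sided by symmetry, together with a squaring $s_{\mathfrak g}:\mathfrak g_{\bar 1}\to\mathfrak g_{\bar 0}$ with $s_{\mathfrak g}(\lambda x)=\lambda^2 s_{\mathfrak g}(x)$ such that $[x,y]_{\mathfrak g}:=s_{\mathfrak g}(x+y)-s_{\mathfrak g}(x)-s_{\mathfrak g}(y)$ is bilinear on $\mathfrak g_{\bar 1}$, and $[s_{\mathfrak g}(x),y]_{\mathfrak g}=[x,[x,y]_{\mathfrak g}]_{\mathfrak g}$ for $x\in\mathfrak g_{\bar 1}$, $y\in\mathfrak g$. A derivation is a linear map $D$ with $D([x,y])=[D(x),y]+[x,D(y)]$ for $x\in\mathfrak g_{\bar 0},y\in\mathfrak g$ and $D(s_{\mathfrak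 g}(x))=[D(x),x]$ for $x\in\mathfrak g_{\bar 1}$. NIS: a non-degenerate invariant ($\mathscr B([x,y],z)=\mathscr B(x,[y,z])$) symmetric bilinear form with $\mathscr B(x,x)=0$ for odd $x$. A Manin triple $(\mathfrak h,\mathfrak g,\mathfrak k)$: $\mathfrak h$ is a Lie superalgebra, $\mathfrak g,\mathfrak k$ are Lie sub-superalgebras with $\mathfrak h=\mathfrak g\oplus\mathfrak k$ as vector spaces, and there is an even NIS $\mathscr B_{\mathfrak h}$ on $\mathfrak h$ for which $\mathfrak g$ and $\mathfrak k$ are isotropic. The special center is $\mathfrak z_s(\mathfrak h):=\mathfrak z(\mathfrak h)\cap s_{\mathfrak h}(\mathfrak h_{\bar 1})^\perp$, with $\mathfrak z(\mathfrak h)$ the center and $\perp$ with respect to $\mathscr B_{\mathfrak h}$. $\mathscr D_{\bar 0}$-double extension of a Manin triple $(\mathfrak c,\mathfrak a,\mathfrak b)$ with NIS $\mathscr B_{\mathfrak c}$: let $\mathscr D$ be an even derivation of $\mathfrak c$ with $\mathscr B_{\mathfrak c}(\mathscr D(u),v)+\mathscr B_{\mathfrak c}(u,\mathscr D(v))=0$ for all $u,v\in\mathfrak c$, $\mathscr B_{\mathfrak c}(\mathscr D(u),u)=0$ for $u\in\mathfrak c_{\bar 0}$, $\mathscr D(\mathfrak b_{\bar 0})\subseteq\mathfrak b_{\bar 0}$, and let $\alpha:\mathfrak c_{\bar 1}\to\mathbb K$ be a quadratic form with $\alpha(u+v)+\alpha(u)+\alpha(v)=\mathscr B_{\mathfrak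 c}(u,\mathscr D(v))$ for $u,v\in\mathfrak c_{\bar 1}$ and $\alpha(\mathfrak b_{\bar 1})=0$. Put $\tilde{\mathfrak c}=\mathbb Kx\oplus\mathfrak c\oplus\mathbb Kx^*$ with $x,x^*$ even, $s_{\tilde{\mathfrak c}}(u)=s_{\mathfrak c}(u)+\alpha(u)x$ for odd $u$, $[x,\tilde{\mathfrak c}]=0$, $[u,v]_{\tilde{\mathfrak c}}=[u,v]_{\mathfrak c}+\mathscr B_{\mathfrak c}(\mathscr D(u),v)x$, $[x^*,u]_{\tilde{\mathfrak c}}=\mathscr D(u)$ ($u,v\in\mathfrak c$), $\tilde{\mathscr B}|_{\mathfrak c\times\mathfrak c}=\mathscr B_{\mathfrak c}$, $\tilde{\mathscr B}(\mathfrak c,x)=\tilde{\mathscr B}(\mathfrak c,x^* )=0$, $\tilde{\mathscr B}(x,x^* )=1$, $\tilde{\mathscr B}(x,x)=\tilde{\mathscr B}(x^*,x^* )=0$. The double extension is the Manin triple $(\tilde{\mathfrak c},\mathbb Kx\oplus\mathfrak a,\mathbb Kx^*\ltimes\mathfrak b)$ with NIS $\tilde{\mathscr B}$.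
   Formalization: When the special center meets k (rather than g) in a nonzero even element, the conclusion is for the triple with g and k exchanged: (h,k,g) is the double extension; for (h,g,k) itself the claim fails, e.g. for g with [e,f]=f, k=g*, h=g⋉g*. *)

(* Defs.v *)
From HB Require Import structures.
From mathcomp Require Import all_boot all_order all_algebra.

Set Implicit Arguments.
Unset Strict Implicit.
Unset Printing Implicit Defensive.

Import GRing.Theory.
Local Open Scope ring_scope.

(* Data of a finite-dimensional superspace with a bracket and a squaring.
   The squaring is meaningful on [odd_part] only; its values elsewhere are
   junk that nothing below refers to. *)
Record superalg (K : fieldType) (V : vectType K) := SuperAlg {
  even_part : {vspace V};
  odd_part : {vspace V};
  bracket : V -> V -> V;
  squaring : V -> V
}.

(* The base field is not assumed here to have characteristic 2: that is a
   hypothesis of each statement that uses these notions. *)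
Record is_lie_superalgebra (K : fieldType) (V : vectType K)
    (L : superalg V) : Prop := IsLieSuperalgebra {
  lie_gradedD : (even_part L + odd_part L)%VS = fullv;
  lie_gradedI : (even_part L :&: odd_part L)%VS = 0%VS;
  lie_linearr : forall u, linear (bracket L u);
  lie_linearl : forall v, linear (fun u => bracket L u v);
  lie_even_even : forall u v, u \in even_part L -> v \in even_part L ->
    bracket L u v \in even_part L;
  lie_even_odd : forall u v, u \in even_part L -> v \in odd_part L ->
    bracket L u v \in odd_part L;
  lie_alternating : forall u, u \in even_part L -> bracket L u u = 0;
  lie_jacobi : forall u v w, u \in even_part L -> v \in even_part L ->
    w \in even_part L ->
    bracket L u (bracket L v w) + bracket L v (bracket L w u)
      + bracket L w (bracket L u v) = 0;
  lie_module : forall u v w, u \in even_part L -> v \in even_part L ->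
    w \in odd_part L ->
    bracket L (bracket L u v) w
      = bracket L u (bracket L v w) - bracket L v (bracket L u w);
  lie_two_sided : forall u v, u \in even_part L -> v \in odd_part L ->
    bracket L v u = bracket L u v;
  lie_sq_even : forall u, u \in odd_part L -> squaring L u \in even_part L;
  lie_sqZ : forall a u, u \in odd_part L ->
    squaring L (a *: u) = a ^+ 2 *: squaring L u;
  lie_sqD : forall u v, u \in odd_part L -> v \in odd_part L ->
    bracket L u v = squaring L (u + v) - squaring L u - squaring L v;
  lie_sq_bracket : forall u v, u \in odd_part L ->
    bracket L (squaring L u) v = bracket L u (bracket L u v)
}.

Record is_sub_superalgebra (K : fieldType) (V : vectType K) (L : superalg V)
    (g : {vspace V}) : Prop := IsSubSuperalgebra {
  sub_graded : g = ((g :&: even_part L) + (g :&: odd_part L))%VS;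
  sub_bracket : forall u v, u \in g -> v \in g -> bracket L u v \in g;
  sub_squaring : forall u, u \in g -> u \in odd_part L -> squaring L u \in g
}.

Record is_derivation (K : fieldType) (V : vectType K) (L : superalg V)
    (D : 'End(V)) : Prop := IsDerivation {
  der_bracket : forall u v, u \in even_part L ->
    D (bracket L u v) = bracket L (D u) v + bracket L u (D v);
  der_squaring : forall u, u \in odd_part L ->
    D (squaring L u) = bracket L (D u) u
}.

Definition is_even_map (K : fieldType) (V : vectType K) (L : superalg V)
    (D : 'End(V)) : Prop :=
  (D @: even_part L <= even_part L)%VS /\ (D @: odd_part L <= odd_part L)%VS.

Record is_even_NIS (K : fieldType) (V : vectType K) (L : superalg V)
    (B : V -> V -> K) : Prop := IsEvenNIS {
  nis_linearr : forall u, scalar (B u);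
  nis_linearl : forall v, scalar (fun u => B u v);
  nis_nondegenerate : forall u, (forall v, B u v = 0) -> u = 0;
  nis_invariant : forall u v w, B (bracket L u v) w = B u (bracket L v w);
  nis_symmetric : forall u v, B u v = B v u;
  nis_odd : forall u, u \in odd_part L -> B u u = 0;
  nis_even : forall u v, u \in even_part L -> v \in odd_part L -> B u v = 0
}.

Definition isotropic (K : fieldType) (V : vectType K) (B : V -> V -> K)
    (g : {vspace V}) : Prop :=
  forall u v, u \in g -> v \in g -> B u v = 0.

(* The form is part of the data, because the special center and double
   extensions depend on it. *)
Record is_manin_triple (K : fieldType) (V : vectType K) (L : superalg V)
    (g k : {vspace V}) (B : V -> V -> K) : Prop := IsManinTriple {
  manin_lie : is_lie_superalgebra L;
  manin_subl : is_sub_superalgebra L g;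
  manin_subr : is_sub_superalgebra L k;
  manin_sum : (g + k)%VS = fullv;
  manin_cap : (g :&: k)%VS = 0%VS;
  manin_form : is_even_NIS L B;
  manin_isol : isotropic B g;
  manin_isor : isotropic B k
}.

Definition in_center (K : fieldType) (V : vectType K) (L : superalg V)
    (z : V) : Prop := forall u, bracket L z u = 0.

Definition in_special_center (K : fieldType) (V : vectType K)
    (L : superalg V) (B : V -> V -> K) (z : V) : Prop :=
  in_center L z /\ (forall u, u \in odd_part L -> B z (squaring L u) = 0).

(* Parities: g and the special center are graded, so the even part of their
   intersection is its intersection with [even_part L]. *)
Definition special_center_meets_even (K : fieldType) (V : vectType K)
    (L : superalg V) (B : V -> V -> K) (g : {vspace V}) : Prop :=
  exists2 z : V, z != 0 &
    [/\ in_special_center L B z, z \in g & z \in even_part L].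

Record is_D0_data (K : fieldType) (C : vectType K) (L : superalg C)
    (b : {vspace C}) (B : C -> C -> K) (D : 'End(C)) (alpha : C -> K) : Prop
    := IsD0Data {
  D0_derivation : is_derivation L D;
  D0_even : is_even_map L D;
  D0_invariant : forall u v, B (D u) v + B u (D v) = 0;
  D0_alternating : forall u, u \in even_part L -> B (D u) u = 0;
  D0_stable : (D @: (b :&: even_part L) <= b :&: even_part L)%VS;
  D0_alphaZ : forall a u, u \in odd_part L -> alpha (a *: u) = a ^+ 2 * alpha u;
  D0_alphaD : forall u v, u \in odd_part L -> v \in odd_part L ->
    alpha (u + v) + alpha u + alpha v = B u (D v);
  D0_alpha_b : forall u, u \in (b :&: odd_part L)%VS -> alpha u = 0
}.

(* In [dext_space], the triple (s, u, t) stands for s x + u + t x^*. *)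
Section DoubleExtension.
Variables (K : fieldType) (C : vectType K).

Definition dext_space : vectType K := (K^o * C * K^o)%type.

Definition dext_x : dext_space := (1, 0, 0).
Definition dext_xstar : dext_space := (0, 0, 1).

Definition dext_inj_fun (u : C) : dext_space := (0, u, 0).

Lemma dext_inj_fun_is_linear : linear dext_inj_fun.
Proof.
move=> a u v; rewrite /dext_inj_fun; congr (_, _, _).
  by rewrite /= scaler0 add0r.
by rewrite /= scaler0 add0r.
Qed.

HB.instance Definition _ := GRing.isLinear.Build K C dext_space _
  dext_inj_fun dext_inj_fun_is_linear.

Definition dext_inj : 'Hom(C, dext_space) := linfun dext_inj_fun.

Lemma dext_injE u : dext_inj u = (0, u, 0).
Proof. by rewrite lfunE. Qed.

(* Outside the image of the odd part the squaring takes junk values. *)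
Definition dext_superalg (L : superalg C) (B : C -> C -> K) (D : 'End(C))
    (alpha : C -> K) : superalg dext_space :=
  {| even_part :=
       (<[dext_x]> + dext_inj @: even_part L + <[dext_xstar]>)%VS;
     odd_part := (dext_inj @: odd_part L)%VS;
     bracket := fun p q : dext_space =>
       (B (D p.1.2) q.1.2,
        bracket L p.1.2 q.1.2 + p.2 *: D q.1.2 + q.2 *: D p.1.2,
        0);
     squaring := fun p : dext_space => (alpha p.1.2, squaring L p.1.2, 0) |}.

Definition dext_form (B : C -> C -> K) (p q : dext_space) : K :=
  B p.1.2 q.1.2 + p.1.1 * q.2 + p.2 * q.1.1.

Definition dext_left (a : {vspace C}) : {vspace dext_space} :=
  (<[dext_x]> + dext_inj @: a)%VS.
Definition dext_right (b : {vspace C}) : {vspace dext_space} :=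
  (<[dext_xstar]> + dext_inj @: b)%VS.

End DoubleExtension.

Record is_manin_isometry (K : fieldType) (V W : vectType K)
    (L : superalg V) (g k : {vspace V}) (B : V -> V -> K)
    (L' : superalg W) (g' k' : {vspace W}) (B' : W -> W -> K)
    (f : 'Hom(V, W)) : Prop := IsManinIsometry {
  iso_bij : bijective f;
  iso_even : (f @: even_part L)%VS = even_part L';
  iso_odd : (f @: odd_part L)%VS = odd_part L';
  iso_bracket : forall u v, f (bracket L u v) = bracket L' (f u) (f v);
  iso_squaring : forall u, u \in odd_part L ->
    f (squaring L u) = squaring L' (f u);
  iso_left : (f @: g)%VS = g';
  iso_right : (f @: k)%VS = k';
  iso_form : forall u v, B' (f u) (f v) = B u v
}.

(* The order of g and k matters: g is the side that receives the central
   element x, and k the side that receives x^*. *)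
Definition is_D0_double_extension (K : fieldType) (V : vectType K)
    (L : superalg V) (g k : {vspace V}) (B : V -> V -> K) : Prop :=
  exists (C : vectType K) (Lc : superalg C) (a b : {vspace C})
         (Bc : C -> C -> K) (D : 'End(C)) (alpha : C -> K)
         (f : 'Hom(V, dext_space C)),
    [/\ is_manin_triple Lc a b Bc,
        is_D0_data Lc b Bc D alpha &
        is_manin_isometry L g k B
          (dext_superalg Lc Bc D alpha) (dext_left a) (dext_right b)
          (dext_form Bc) f].

(* Main.v *)
From HB Require Import structures.
Require Import Defs.
From mathcomp Require Import all_boot all_order all_algebra.

Set Implicit Arguments.
Unset Strict Implicit.
Unset Printing Implicit Defensive.

Import GRing.Theory.
Local Open Scope ring_scope.

(** Write [,] for the bracket, s for the squaring and B for the form on h.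
    Let x be a nonzero even element of g in the special center.  As g is
    isotropic, B is nondegenerate and even, and k is graded, x pairs
    nontrivially with an even element of k, so some even xs in k satisfies
    B x xs = 1 (manin_dual_vector).  The plane P spanned by x and xs is
    hyperbolic, hence h is the orthogonal sum of P and its complement C.

    The complement C plays the part of the quotient of the orthogonal of x by
    the line of x.  Since x is central, B x [u, v] = B [x, u] v = 0: brackets
    land in the orthogonal of x.  The special center condition says precisely
    that squares land there too.  So brackets and squares of elements of C are
    an element of C plus a multiple of x, and since x is central, dropping
    that multiple preserves every identity of a Lie superalgebra
    (reduced_lie_superalgebra).  The pieces of g and k in C make up a Manin
    triple (reduced_manin_triple).

    The dropped multiples are B xs [u, v] = B [xs, u] v and B xs (s u).  Thus
    D = [xs, .] and alpha = B xs (s .) are the data of the double extension: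
    D is a derivation because xs is even, it stays inside C because
    [xs, xs] = 0, and both are compatible with k because k is an isotropic
    subalgebra containing xs (reduced_D0_data).  The isometry onto the double
    extension sends v to (B xs v, projection of v to C, B x v)
    (dext_map_isometry).  A special central element of k is handled by
    exchanging g and k, since Manin triples are symmetric in them. *)

(** * Linear maps and characteristic 2 *)

Section LinearAlgebra.
Variables (K : fieldType) (V W : vectType K).

(** For a map known to be linear only through a hypothesis, such as a bracket
    or a form with one argument fixed, without a declared linear structure. *)
Lemma linfun_linearE (f : V -> W) : linear f -> linfun f =1 f.
Proof.
move=> f_lin v.
pose F : {linear V -> W} := HB.pack f (GRing.isLinear.Build K V W *:%R f f_lin).
exact: (lfunE F v).
Qed.

(** The complement of the plane is used as a space of its own through an
    inclusion i and a projection p; this keeps the later arguments free of the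
    subtype of a subspace. *)
Lemma idempotent_splits (e : 'End(V)) : (forall v, e (e v) = e v) ->
  exists (C : vectType K) (i : 'Hom(C, V)) (p : 'Hom(V, C)),
    (forall c, p (i c) = c) /\ (forall v, i (p v) = e v).
Proof.
move=> ee.
exists (subvs_of (limg e)), (linfun vsval).
exists (linfun (vsproj (limg e)) \o e)%VF; split=> [c|v].
  rewrite comp_lfunE !lfunE /=.
  have /memv_imgP[v _ def_c] := subvsP c.
  by rewrite def_c ee -def_c vsvalK.
by rewrite comp_lfunE !lfunE /= vsprojK // memv_img ?memvf.
Qed.

Lemma bij_limg_eq (f : 'Hom(V, W)) (U : {vspace V}) (U' : {vspace W}) :
  bijective f -> (forall v, (f v \in U') = (v \in U)) -> (f @: U)%VS = U'.
Proof.
move=> [g fK gK] fU; apply/vspaceP=> w; apply/memv_imgP/idP => [[v Uv ->]|Uw].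
  by rewrite fU.
by exists (g w); rewrite ?gK // -fU gK.
Qed.

End LinearAlgebra.

Section Char2.
Variables (K : fieldType) (charK : (2%N \in [pchar K]%R)) (V : lmodType K).

Lemma oppv2 (v : V) : - v = v.
Proof.
apply/eqP; rewrite eq_sym -addr_eq0 -mulr2n -scaler_nat (pcharf0 charK).
by rewrite scale0r.
Qed.

End Char2.

(** * Lie superalgebras in characteristic 2 *)

Section LieSuperalgebra.
Variables (K : fieldType) (V : vectType K) (L : superalg V).
Hypothesis HL : is_lie_superalgebra L.

Local Notation "[ u , v ]" := (bracket L u v).

Lemma lie_gradedP u : exists e o,
  [/\ e \in even_part L, o \in odd_part L & u = e + o].
Proof.
have /memv_addP[e Ee [o Oo ->]] : u \in (even_part L + odd_part L)%VS.
  by rewrite (lie_gradedD HL) memvf.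
by exists e, o.
Qed.

Lemma bracketDr u v w : [u, v + w] = [u, v] + [u, w].
Proof. by have := lie_linearr HL u 1 v w; rewrite !scale1r. Qed.

Lemma bracketDl u v w : [u + v, w] = [u, w] + [v, w].
Proof. by have := lie_linearl HL w 1 u v; rewrite !scale1r. Qed.

Lemma bracket0r u : [u, 0] = 0.
Proof. by apply: (addrI [u, 0]); rewrite -bracketDr !addr0. Qed.

Lemma bracketZr u a v : [u, a *: v] = a *: [u, v].
Proof. by have := lie_linearr HL u a v 0; rewrite bracket0r !addr0. Qed.

Hypothesis charK : (2%N \in [pchar K]%R).

(** Holds on each parity: even elements anticommute, which is commuting in
    characteristic 2; mixed brackets are two-sided by convention; and on the
    odd part the bracket is the polarization of the squaring. *)
Lemma bracketC u v : [u, v] = [v, u].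
Proof.
have [e [o [Ee Oo ->]]] := lie_gradedP u.
have [e' [o' [Ee' Oo' ->]]] := lie_gradedP v.
have eeC : [e, e'] = [e', e].
  have := lie_alternating HL (memvD Ee Ee').
  rewrite bracketDl !bracketDr !(lie_alternating HL) // addr0 add0r.
  by move/eqP; rewrite addr_eq0 (oppv2 charK) => /eqP.
have ooC : [o, o'] = [o', o].
  by rewrite !(lie_sqD HL) // [o' + o]addrC addrAC.
rewrite !(bracketDl, bracketDr) eeC ooC.
by rewrite (lie_two_sided HL Ee' Oo) (lie_two_sided HL Ee Oo') addrACA.
Qed.

Lemma bracketZl u a v : [a *: u, v] = a *: [u, v].
Proof. by rewrite bracketC bracketZr bracketC. Qed.

(** The Jacobi identity for even w and the module axiom for odd w, put in the
    same form. *)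
Lemma ad_even_bracket u v w : u \in even_part L -> v \in even_part L ->
  [u, [v, w]] = [[u, v], w] + [v, [u, w]].
Proof.
move=> Eu Ev; have [e [o [Ee Oo ->]]] := lie_gradedP w.
rewrite !bracketDr addrACA; congr (_ + _); last first.
  by rewrite (lie_module HL Eu Ev Oo) subrK.
have := lie_jacobi HL Eu Ev Ee.
rewrite [[e, u]]bracketC [[e, [u, v]]]bracketC -addrA => /eqP.
by rewrite addr_eq0 (oppv2 charK) addrC => /eqP.
Qed.

Lemma ad_even_derivation (z : V) (D : 'End(V)) : z \in even_part L ->
  (forall u, D u = [z, u]) -> is_derivation L D.
Proof.
move=> Ez DE; split=> [u v Eu | u Ou]; rewrite !DE.
  exact: ad_even_bracket.
by rewrite bracketC (lie_sq_bracket HL) // bracketC [[u, z]]bracketC.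
Qed.

End LieSuperalgebra.

(** * Forms and Manin triples *)

Section EvenForm.
Variables (K : fieldType) (V : vectType K) (L : superalg V) (B : V -> V -> K).
Hypothesis HB : is_even_NIS L B.

Lemma formDr u v w : B u (v + w) = B u v + B u w.
Proof. by have := nis_linearr HB u 1 v w; rewrite scale1r mul1r. Qed.

Lemma form0r u : B u 0 = 0.
Proof. by apply: (addrI (B u 0)); rewrite -formDr !addr0. Qed.

Lemma formZr u a v : B u (a *: v) = a * B u v.
Proof. by have := nis_linearr HB u a v 0; rewrite form0r !addr0. Qed.

Lemma formBr u v w : B u (v - w) = B u v - B u w.
Proof. by rewrite -scaleN1r formDr formZr mulN1r. Qed.

Lemma formDl u v w : B (u + v) w = B u w + B v w.
Proof. by rewrite !(nis_symmetric HB _ w) formDr. Qed.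

Lemma formZl u a v : B (a *: u) v = a * B u v.
Proof. by rewrite !(nis_symmetric HB _ v) formZr. Qed.

End EvenForm.

Section ManinTriple.
Variables (K : fieldType) (V : vectType K) (L : superalg V).
Variables (g k : {vspace V}) (B : V -> V -> K).
Hypothesis HM : is_manin_triple L g k B.

Lemma manin_triple_swap : is_manin_triple L k g B.
Proof. by case: HM => ? ? ? ? ? ? ? ?; split; rewrite // (addvC, capvC). Qed.

Lemma sub_superalgebra_gradedP (U : {vspace V}) u :
  is_sub_superalgebra L U -> u \in U ->
  exists e o, [/\ e \in U, e \in even_part L, o \in U, o \in odd_part L
                & u = e + o].
Proof.
move=> HU; rewrite {1}(sub_graded HU) => /memv_addP[e Ue [o Uo ->]].
by move: Ue Uo; rewrite !memv_cap => /andP[? ?] /andP[? ?]; exists e, o.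
Qed.

(** If the even part of k were orthogonal to x, then x would be orthogonal to
    all of h, since g is isotropic and odd elements are orthogonal to even
    ones; this contradicts nondegeneracy. *)
Lemma manin_dual_vector x : x != 0 -> x \in g -> x \in even_part L ->
  exists2 xs, xs \in k & xs \in even_part L /\ B x xs = 1.
Proof.
move=> nz_x gx Ex; have FB := manin_form HM.
have BxE : linfun (B x : V -> K^o) =1 B x.
  exact: (@linfun_linearE _ _ K^o (B x) (nis_linearr FB x)).
have : ~~ (k :&: even_part L <= lker (linfun (B x : V -> K^o)))%VS.
  apply: contra nz_x => /subvP kx; apply/eqP/(nis_nondegenerate FB) => v.
  have : v \in (g + k)%VS by rewrite (manin_sum HM) memvf.
  case/memv_addP=> y gy [y' ky' ->]; rewrite (formDr FB) (manin_isol HM gx gy).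
  have [e [o [ke Ee _ Oo ->]]] := sub_superalgebra_gradedP (manin_subr HM) ky'.
  rewrite add0r (formDr FB) (nis_even FB Ex Oo) addr0.
  have /kx : e \in (k :&: even_part L)%VS by rewrite memv_cap ke.
  by rewrite memv_ker BxE => /eqP.
case/subvPn=> y; rewrite memv_cap memv_ker BxE => /andP[ky Ey] nz_xy.
exists ((B x y)^-1 *: y); rewrite ?memvZ //.
by split; rewrite ?memvZ // (formZr FB) mulVf.
Qed.

End ManinTriple.

(** * Coordinates in the double extension *)

Section DextParts.
Variables (K : fieldType) (C : vectType K).

Lemma mem_dext_inj (U : {vspace C}) (q : dext_space C) :
  (q \in dext_inj C @: U)%VS = [&& q.1.1 == 0, q.1.2 \in U & q.2 == 0].
Proof.
case: q => [[s u] t]; apply/memv_imgP/and3P => /= [[v Uv]|[/eqP-> Uu /eqP->]].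
  by rewrite dext_injE => -[-> -> ->].
by exists u; rewrite ?dext_injE.
Qed.

Lemma mem_dext_left (a : {vspace C}) (q : dext_space C) :
  (q \in dext_left a) = (q.1.2 \in a) && (q.2 == 0).
Proof.
apply/memv_addP/andP => [[? /vlineP[s ->] [q' aq' ->]]|[aq q2]].
  move: aq'; rewrite mem_dext_inj => /and3P[_ aq' /eqP q'2] /=.
  by rewrite q'2 !scaler0 !add0r.
exists (q.1.1 *: dext_x C); first by rewrite memvZ ?memv_line.
exists (dext_inj C q.1.2); first exact: memv_img.
case: q aq q2 => [[s u] t] _ /eqP/= ->; rewrite dext_injE.
by congr (_, _, _); rewrite /= ?scaler0 ?addr0 ?add0r //; exact/esym/mulr1.
Qed.

Lemma mem_dext_right (b : {vspace C}) (q : dext_space C) :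
  (q \in dext_right b) = (q.1.1 == 0) && (q.1.2 \in b).
Proof.
apply/memv_addP/andP => [[? /vlineP[s ->] [q' bq' ->]]|[q1 bq]].
  move: bq'; rewrite mem_dext_inj => /and3P[/eqP q'1 bq' _] /=.
  by rewrite q'1 !scaler0 !add0r.
exists (q.2 *: dext_xstar C); first by rewrite memvZ ?memv_line.
exists (dext_inj C q.1.2); first exact: memv_img.
case: q bq q1 => [[s u] t] _ /eqP/= ->; rewrite dext_injE.
by congr (_, _, _); rewrite /= ?scaler0 ?addr0 ?add0r //; exact/esym/mulr1.
Qed.

Lemma mem_dext_even (E : {vspace C}) (q : dext_space C) :
  (q \in <[dext_x C]> + dext_inj C @: E + <[dext_xstar C]>)%VS = (q.1.2 \in E).
Proof.
apply/memv_addP/idP => [[q' + [? /vlineP[t ->] ->]]|Eq].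
  by rewrite mem_dext_left => /andP[Eq' _] /=; rewrite scaler0 addr0.
exists (q.1.1, q.1.2, 0); first by rewrite mem_dext_left /= Eq eqxx.
exists (q.2 *: dext_xstar C); first by rewrite memvZ ?memv_line.
case: q Eq => [[s u] t] _.
by congr (_, _, _); rewrite /= ?scaler0 ?addr0 ?add0r //; exact/esym/mulr1.
Qed.

End DextParts.

(** * Reduction by a special central element *)

Section Reduction.
Variables (K : fieldType) (V : vectType K) (L : superalg V).
Variables (g k : {vspace V}) (B : V -> V -> K) (x xs : V).
Hypothesis charK : (2%N \in [pchar K]%R).
Hypothesis HM : is_manin_triple L g k B.
Hypothesis xz : in_special_center L B x.
Hypotheses (gx : x \in g) (Ex : x \in even_part L).
Hypotheses (kxs : xs \in k) (Exs : xs \in even_part L).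
Hypothesis Bxxs : B x xs = 1.

Let HL : is_lie_superalgebra L := manin_lie HM.
Let FB : is_even_NIS L B := manin_form HM.

Local Notation "[ u , v ]" := (bracket L u v).

Let Bxx : B x x = 0. Proof. exact: (manin_isol HM). Qed.
Let Bxsxs : B xs xs = 0. Proof. exact: (manin_isor HM). Qed.
Let Bxsx : B xs x = 1. Proof. by rewrite (nis_symmetric FB). Qed.
Let brx u : [x, u] = 0. Proof. exact: (xz.1 u). Qed.
Let bxr u : [u, x] = 0. Proof. by rewrite (bracketC HL charK) brx. Qed.
Let brxsxs : [xs, xs] = 0. Proof. exact: (lie_alternating HL). Qed.

Lemma central_perp_bracket u v : B x [u, v] = 0.
Proof.
by rewrite -(nis_invariant FB) brx (nis_symmetric FB) (form0r FB).
Qed.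

Lemma xs_perp_ad_xs u : B xs [xs, u] = 0.
Proof.
by rewrite -(nis_invariant FB) brxsxs (nis_symmetric FB) (form0r FB).
Qed.

(** Since x and xs are isotropic with B x xs = 1, the coordinate of v along x
    is B xs v and the one along xs is B x v. *)
Definition plane_perp_proj (v : V) : V := v - (B xs v *: x + B x v *: xs).

Lemma plane_perp_proj_linear : linear plane_perp_proj.
Proof.
move=> a u v; rewrite /plane_perp_proj !(formDr FB) !(formZr FB) !scalerDl.
rewrite scalerBr scalerDr !scalerA [RHS]addrACA -opprD.
by congr (_ + - _); rewrite addrACA.
Qed.

Lemma plane_perp_projK v :
  plane_perp_proj (plane_perp_proj v) = plane_perp_proj v.
Proof.
rewrite {1}/plane_perp_proj /plane_perp_proj !(formBr FB) !(formDr FB).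
rewrite !(formZr FB) Bxsx Bxxs Bxx Bxsxs !mulr1 !mulr0 addr0 add0r !subrr.
by rewrite !scale0r addr0 subr0.
Qed.

Variables (C : vectType K) (i : 'Hom(C, V)) (p : 'Hom(V, C)).
Hypothesis iK : forall c, p (i c) = c.
Hypothesis pE : forall v, i (p v) = plane_perp_proj v.

Lemma plane_decomp v : v = B xs v *: x + i (p v) + B x v *: xs.
Proof. by rewrite addrAC pE addrC subrK. Qed.

Lemma form_x_incl c : B x (i c) = 0.
Proof.
rewrite -(iK c) pE /plane_perp_proj (formBr FB) (formDr FB) !(formZr FB).
by rewrite Bxx Bxxs mulr0 mulr1 add0r subrr.
Qed.

Lemma form_xs_incl c : B xs (i c) = 0.
Proof.
rewrite -(iK c) pE /plane_perp_proj (formBr FB) (formDr FB) !(formZr FB).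
by rewrite Bxsx Bxsxs mulr0 mulr1 addr0 subrr.
Qed.

Lemma proj_x : p x = 0.
Proof.
rewrite -(iK (p x)) pE /plane_perp_proj Bxsx Bxx scale1r scale0r addr0 subrr.
exact: linear0.
Qed.

Lemma proj_xs : p xs = 0.
Proof.
rewrite -(iK (p xs)) pE /plane_perp_proj Bxxs Bxsxs scale1r scale0r add0r subrr.
exact: linear0.
Qed.

Lemma form_proj_perp u w : B x w = 0 -> B xs w = 0 -> B (i (p u)) w = B u w.
Proof.
move=> xw xsw; rewrite [in RHS](plane_decomp u) !(formDl FB) !(formZl FB).
by rewrite xw xsw !mulr0 add0r addr0.
Qed.

Lemma form_incl_proj u c : B (i (p u)) (i c) = B u (i c).
Proof. exact: form_proj_perp (form_x_incl c) (form_xs_incl c). Qed.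

(** On the orthogonal of x the projection only changes w by a multiple of the
    central element x, which no bracket can detect. *)
Lemma bracket_incl_proj u w : B x w = 0 -> [u, i (p w)] = [u, w].
Proof.
move=> xw; rewrite [in RHS](plane_decomp w) xw scale0r addr0.
by rewrite (bracketDr HL) (bracketZr HL) bxr scaler0 add0r.
Qed.

Lemma bracket_xs_incl_proj u : [xs, i (p u)] = [xs, u].
Proof.
rewrite [in RHS](plane_decomp u) !(bracketDr HL) !(bracketZr HL) bxr brxsxs.
by rewrite !scaler0 add0r addr0.
Qed.

Lemma proj_even u : u \in even_part L -> i (p u) \in even_part L.
Proof. by move=> Eu; rewrite pE rpredB ?rpredD ?memvZ. Qed.

Lemma incl_proj_odd u : u \in odd_part L -> i (p u) = u.
Proof.
move=> Ou; rewrite pE /plane_perp_proj !(nis_even FB) // !scale0r addr0.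
exact: subr0.
Qed.

(** An element of g is orthogonal to x, so that projecting it subtracts only a
    multiple of x, which lies in g; for k the same holds with xs. *)
Lemma proj_left u : u \in g -> i (p u) \in g.
Proof.
move=> gu; rewrite pE /plane_perp_proj (manin_isol HM gx gu) scale0r addr0.
by rewrite rpredB ?memvZ.
Qed.

Lemma proj_right u : u \in k -> i (p u) \in k.
Proof.
move=> ku; rewrite pE /plane_perp_proj (manin_isor HM kxs ku) scale0r add0r.
by rewrite rpredB ?memvZ.
Qed.

Definition reduced_superalg : superalg C := {|
  even_part := (i @^-1: even_part L)%VS;
  odd_part := (i @^-1: odd_part L)%VS;
  bracket := fun u v => p [i u, i v];
  squaring := fun u => p (squaring L (i u)) |}.

Definition reduced_form (u v : C) : K := B (i u) (i v).

Definition reduced_derivation : 'End(C) :=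
  linfun (fun u => p [xs, i u]).

Definition reduced_quadratic (u : C) : K := B xs (squaring L (i u)).

Local Notation Lc := reduced_superalg.
Local Notation D := reduced_derivation.

Lemma reduced_derivationE u : D u = p [xs, i u].
Proof.
apply: linfun_linearE => a v w.
by rewrite linearP (bracketDr HL) (bracketZr HL) linearP.
Qed.

Lemma reduced_derivation_proj u : D (p u) = p [xs, u].
Proof. by rewrite reduced_derivationE bracket_xs_incl_proj. Qed.

(** [xs, .] maps into the orthogonal of x and, as [xs, xs] = 0, into that of
    xs, so the projection in the definition of D does nothing. *)
Lemma incl_reduced_derivation u : i (D u) = [xs, i u].
Proof.
rewrite reduced_derivationE pE /plane_perp_proj central_perp_bracket.
by rewrite xs_perp_ad_xs !scale0r addr0 subr0.
Qed.

(** Iterated brackets can be computed in h and projected once at the end; with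
    its mirror image below, this transports the Jacobi-type identities. *)
Lemma reduced_bracket_projr u v w :
  bracket Lc u (p [v, w]) = p [i u, [v, w]].
Proof. by rewrite /= (bracket_incl_proj _ (central_perp_bracket v w)). Qed.

Lemma reduced_bracketC u v : bracket Lc u v = bracket Lc v u.
Proof. by rewrite /= (bracketC HL charK). Qed.

Lemma reduced_bracket_projl u v w :
  bracket Lc (p [v, w]) u = p [[v, w], i u].
Proof.
by rewrite reduced_bracketC reduced_bracket_projr (bracketC HL charK).
Qed.

Lemma x_perp_squaring u : u \in odd_part L -> B x (squaring L u) = 0.
Proof. exact: xz.2. Qed.

(** Every axiom is the projection of the same axiom in h; the ones with a
    nested bracket or squaring use that x is orthogonal to brackets and to
    squares, the latter being the special center condition. *)
Lemma reduced_lie_superalgebra : is_lie_superalgebra Lc.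
Proof.
split.
- apply/eqP; rewrite eqEsubv subvf; apply/subvP=> c _.
  have [e [o [Ee Oo def_c]]] := lie_gradedP HL (i c).
  rewrite -(iK c) def_c linearD memv_add // -memv_preim ?proj_even //.
  by rewrite incl_proj_odd.
- apply/eqP; rewrite -subv0; apply/subvP=> c.
  rewrite memv_cap -!memv_preim -memv_cap (lie_gradedI HL) !memv0.
  by move/eqP=> ic0; rewrite -(iK c) ic0 linear0.
- move=> u a v w /=.
  by rewrite linearP (bracketDr HL) (bracketZr HL) linearP.
- move=> u a v w; rewrite !(reduced_bracketC _ u) /=.
  by rewrite linearP (bracketDr HL) (bracketZr HL) linearP.
- move=> u v; rewrite -!memv_preim => Eu Ev.
  exact/proj_even/(lie_even_even HL).
- move=> u v; rewrite -!memv_preim => Eu Ov.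
  by have Ouv := lie_even_odd HL Eu Ov; rewrite incl_proj_odd.
- move=> u; rewrite -memv_preim => Eu.
  by rewrite /= (lie_alternating HL Eu) linear0.
- move=> u v w; rewrite -!memv_preim => Eu Ev Ew.
  by rewrite !reduced_bracket_projr -!linearD (lie_jacobi HL) ?linear0.
- move=> u v w; rewrite -!memv_preim => Eu Ev Ow.
  rewrite !reduced_bracket_projr reduced_bracket_projl.
  by rewrite (lie_module HL Eu Ev Ow) linearB.
- by move=> u v _ _; rewrite reduced_bracketC.
- move=> u; rewrite -!memv_preim => Ou.
  exact/proj_even/(lie_sq_even HL).
- move=> a u; rewrite -memv_preim => Ou.
  by rewrite /= linearZ (lie_sqZ HL) // linearZ.
- move=> u v; rewrite -!memv_preim => Ou Ov.
  by rewrite /= (lie_sqD HL Ou Ov) !linearB linearD.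
- move=> u v; rewrite -memv_preim => Ou.
  rewrite reduced_bracket_projr /= (bracketC HL charK).
  rewrite (bracket_incl_proj _ (x_perp_squaring Ou)) (bracketC HL charK).
  by rewrite (lie_sq_bracket HL).
Qed.

Lemma reduced_sub_superalgebra (U : {vspace V}) :
  is_sub_superalgebra L U -> (forall u, u \in U -> i (p u) \in U) ->
  is_sub_superalgebra Lc (i @^-1: U).
Proof.
move=> HU pU; split.
- apply/eqP; rewrite eqEsubv subv_add !capvSl !andbT; apply/subvP=> c.
  rewrite -memv_preim => /(sub_superalgebra_gradedP HU).
  move=> [e [o [Ue Ee Uo Oo def_c]]].
  rewrite -(iK c) def_c linearD memv_add // memv_cap -!memv_preim pU //=.
    exact: proj_even.
  by rewrite incl_proj_odd.
- move=> u v; rewrite -!memv_preim => Uu Uv.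
  exact/pU/(sub_bracket HU).
- move=> u; rewrite -!memv_preim => Uu Ou.
  exact/pU/(sub_squaring HU).
Qed.

(** Nondegeneracy and invariance come from C being the orthogonal of a plane:
    pairing with an element of C ignores the components along x and xs. *)
Lemma reduced_even_NIS : is_even_NIS Lc reduced_form.
Proof.
split.
- move=> u a v w.
  by rewrite /reduced_form linearP (formDr FB) (formZr FB).
- move=> u a v w.
  by rewrite /reduced_form linearP (formDl FB) (formZl FB).
- move=> u Bu0; rewrite -(iK u) (nis_nondegenerate FB (u := i u)) ?linear0 //.
  move=> v; rewrite (nis_symmetric FB) -form_incl_proj (nis_symmetric FB).
  exact: Bu0.
- move=> u v w; rewrite /reduced_form form_incl_proj (nis_invariant FB).
  by rewrite [RHS](nis_symmetric FB) form_incl_proj (nis_symmetric FB).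
- by move=> u v; rewrite /reduced_form (nis_symmetric FB).
- by move=> u; rewrite -memv_preim; exact: (nis_odd FB).
- by move=> u v; rewrite -!memv_preim; exact: (nis_even FB).
Qed.

Lemma reduced_manin_triple :
  is_manin_triple Lc (i @^-1: g) (i @^-1: k) reduced_form.
Proof.
split.
- exact: reduced_lie_superalgebra.
- exact: (reduced_sub_superalgebra (manin_subl HM) proj_left).
- exact: (reduced_sub_superalgebra (manin_subr HM) proj_right).
- apply/eqP; rewrite eqEsubv subvf; apply/subvP=> c _.
  have : i c \in (g + k)%VS by rewrite (manin_sum HM) memvf.
  case/memv_addP=> u gu [v kv def_c].
  by rewrite -(iK c) def_c linearD memv_add // -memv_preim;
    [exact: proj_left | exact: proj_right].
- apply/eqP; rewrite -subv0; apply/subvP=> c.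
  rewrite memv_cap -!memv_preim -memv_cap (manin_cap HM) !memv0.
  by move/eqP=> ic0; rewrite -(iK c) ic0 linear0.
- exact: reduced_even_NIS.
- by move=> u v; rewrite -!memv_preim; exact: (manin_isol HM).
- by move=> u v; rewrite -!memv_preim; exact: (manin_isor HM).
Qed.

(** D is the projection of the inner derivation of the even element xs, and the
    polarization of alpha is B xs [u, v], which invariance turns into
    B [xs, u] v.  The vanishing of alpha on the odd part of k holds because xs
    and the squares of odd elements of k lie in the isotropic subalgebra k. *)
Lemma reduced_D0_data :
  is_D0_data Lc (i @^-1: k) reduced_form D reduced_quadratic.
Proof.
have Dinv u v : reduced_form (D u) v = reduced_form u (D v).
  rewrite /reduced_form !incl_reduced_derivation.
  by rewrite (bracketC HL charK) (nis_invariant FB).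
pose ad := linfun (bracket L xs).
have adE : ad =1 bracket L xs := linfun_linearE (lie_linearr HL xs).
have [ad_bracket ad_squaring] := ad_even_derivation HL charK Exs adE.
split.
- split=> [u v|u]; rewrite -memv_preim => Pu.
    rewrite [in RHS]reduced_derivationE [in RHS](reduced_derivationE v).
    rewrite reduced_bracket_projl reduced_bracket_projr -linearD.
    by rewrite reduced_derivation_proj -!adE ad_bracket.
  rewrite [in RHS]reduced_derivationE reduced_bracket_projl.
  by rewrite reduced_derivation_proj -!adE ad_squaring.
- split; apply/subvP=> _ /memv_imgP[u + ->]; rewrite -!memv_preim => Pu;
    rewrite incl_reduced_derivation.
    exact: (lie_even_even HL).
  exact: (lie_even_odd HL).
- by move=> u v; rewrite Dinv (addrr_pchar2 charK).
- move=> u; rewrite -memv_preim => Eu.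
  rewrite /reduced_form incl_reduced_derivation (nis_invariant FB).
  by rewrite (lie_alternating HL Eu) (form0r FB).
- apply/subvP=> _ /memv_imgP[u + ->].
  rewrite !memv_cap -!memv_preim incl_reduced_derivation => /andP[ku Eu].
  by rewrite (sub_bracket (manin_subr HM)) // (lie_even_even HL).
- move=> a u; rewrite -memv_preim /reduced_quadratic => Ou.
  by rewrite linearZ (lie_sqZ HL) // (formZr FB).
- move=> u v; rewrite -!memv_preim -Dinv => Ou Ov.
  rewrite /reduced_form /reduced_quadratic incl_reduced_derivation linearD.
  rewrite (nis_invariant FB) (lie_sqD HL) // !(formBr FB).
  by rewrite !(oppr_pchar2 charK).
- move=> u; rewrite memv_cap -!memv_preim => /andP[ku Ou].
  exact/(manin_isor HM kxs)/(sub_squaring (manin_subr HM)).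
Qed.

(** * The isometry onto the double extension *)

Definition dext_map_fun (v : V) : dext_space C := (B xs v, p v, B x v).

Lemma dext_map_fun_linear : linear dext_map_fun.
Proof.
move=> a u v; rewrite /dext_map_fun linearP !(formDr FB) !(formZr FB).
by congr (_, _, _).
Qed.

Definition dext_map : 'Hom(V, dext_space C) := linfun dext_map_fun.

Lemma dext_mapE v : dext_map v = (B xs v, p v, B x v).
Proof. exact: (linfun_linearE dext_map_fun_linear v). Qed.

Lemma dext_map_bij : bijective dext_map.
Proof.
exists (fun q => q.1.1 *: x + i q.1.2 + q.2 *: xs) => [v|[[s u] t]].
  by rewrite dext_mapE -plane_decomp.
rewrite dext_mapE /= !linearD !linearZ /= iK proj_x proj_xs !(formDr FB).
rewrite !(formZr FB) form_x_incl form_xs_incl Bxsx Bxx Bxsxs Bxxs.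
by rewrite !scaler0 !mulr0 !mulr1 !add0r !addr0.
Qed.

(** Bracketing with u and v expanded along x, C and xs kills the x terms and
    turns the xs terms into D; the component along x is B xs [u, v], that is
    B [xs, u] v, which only sees the projections of both sides to C. *)
Lemma dext_map_bracket u v :
  dext_map [u, v]
    = bracket (dext_superalg Lc reduced_form D reduced_quadratic)
        (dext_map u) (dext_map v).
Proof.
rewrite !dext_mapE /= central_perp_bracket; congr (_, _, _).
  rewrite /reduced_form reduced_derivation_proj form_incl_proj.
  rewrite [RHS](nis_symmetric FB) form_proj_perp ?central_perp_bracket //.
    by rewrite [RHS](nis_symmetric FB) (nis_invariant FB).
  exact: xs_perp_ad_xs.
rewrite !reduced_derivation_proj [in LHS](plane_decomp u).
rewrite !(bracketDl HL) !(bracketZl HL charK) brx scaler0 add0r.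
rewrite [in [i (p u), v]](plane_decomp v) !(bracketDr HL) !(bracketZr HL) bxr.
rewrite scaler0 add0r (bracketC HL charK _ xs) bracket_xs_incl_proj.
by rewrite !linearD !linearZ addrAC.
Qed.

Lemma dext_map_isometry :
  is_manin_isometry L g k B
    (dext_superalg Lc reduced_form D reduced_quadratic)
    (dext_left (i @^-1: g)) (dext_right (i @^-1: k)) (dext_form reduced_form)
    dext_map.
Proof.
split.
- exact: dext_map_bij.
- apply: bij_limg_eq dext_map_bij _ => v.
  rewrite dext_mapE mem_dext_even -memv_preim /=.
  apply/idP/idP=> [Ev|]; last exact: proj_even.
  by rewrite (plane_decomp v) !memvD ?memvZ.
- apply: bij_limg_eq dext_map_bij _ => v.
  rewrite dext_mapE mem_dext_inj -memv_preim /=.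
  apply/and3P/idP=> [[/eqP xs0 Ov /eqP x0]|Ov].
    by rewrite (plane_decomp v) xs0 x0 !scale0r add0r addr0.
  by rewrite incl_proj_odd // !(nis_even FB) ?eqxx.
- exact: dext_map_bracket.
- move=> u Ou; rewrite !dext_mapE /= /reduced_quadratic incl_proj_odd //.
  by rewrite x_perp_squaring.
- apply: bij_limg_eq dext_map_bij _ => v.
  rewrite dext_mapE mem_dext_left -memv_preim /=.
  apply/andP/idP=> [[gv /eqP x0]|gv].
    by rewrite (plane_decomp v) x0 scale0r addr0 memvD ?memvZ.
  by rewrite proj_left // (manin_isol HM) ?eqxx.
- apply: bij_limg_eq dext_map_bij _ => v.
  rewrite dext_mapE mem_dext_right -memv_preim /=.
  apply/andP/idP=> [[/eqP xs0 kv]|kv].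
    by rewrite (plane_decomp v) xs0 scale0r add0r memvD ?memvZ.
  by rewrite proj_right // (manin_isor HM) ?eqxx.
- move=> u v; rewrite !dext_mapE /dext_form /= /reduced_form.
  rewrite [in RHS](plane_decomp v) !(formDr FB) !(formZr FB).
  rewrite form_incl_proj (nis_symmetric FB u x) (nis_symmetric FB u xs).
  rewrite [B x u * _]mulrC [B xs u * _]mulrC addrAC.
  by rewrite [B u _ + _]addrC.
Qed.

End Reduction.

Lemma special_center_double_extension (K : fieldType) (V : vectType K)
    (L : superalg V) (g k : {vspace V}) (B : V -> V -> K) :
  2%N \in [pchar K] -> is_manin_triple L g k B ->
  special_center_meets_even L B g -> is_D0_double_extension L g k B.
Proof.
move=> charK HM [x nz_x [xz gx Ex]].
have [xs kxs [Exs Bxxs]] := manin_dual_vector HM nz_x gx Ex.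
pose e : 'End(V) := linfun (plane_perp_proj B x xs).
have eE : e =1 plane_perp_proj B x xs.
  exact: (linfun_linearE (plane_perp_proj_linear x xs HM)).
have [|C [i [p [iK pE]]]] := @idempotent_splits K V e.
  by move=> v; rewrite !eE (plane_perp_projK HM).
have {}pE v : i (p v) = plane_perp_proj B x xs v by rewrite pE eE.
exists C, (reduced_superalg L i p), (i @^-1: g)%VS, (i @^-1: k)%VS.
exists (reduced_form B i), (reduced_derivation L xs i p).
exists (reduced_quadratic L B xs i), (dext_map B x xs p).
split.
- exact: (reduced_manin_triple charK HM xz gx Ex kxs Exs Bxxs iK pE).
- exact: (reduced_D0_data charK HM xz kxs Exs pE).
- exact: (dext_map_isometry charK HM xz gx Ex kxs Exs Bxxs iK pE).
Qed.

Theorem theorem4p2p2 (K : fieldType) (charK : (2%N \in [pchar K]%R))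
    (V : vectType K) (h : superalg V) (g k : {vspace V}) (B : V -> V -> K)
    (hgk : is_manin_triple h g k B) (dim_h : (1 < \dim (fullv : {vspace V}))%N) :
  (special_center_meets_even h B g -> is_D0_double_extension h g k B) /\
  (special_center_meets_even h B k -> is_D0_double_extension h k g B).
Proof.
by split; apply: special_center_double_extension => //;
  exact: manin_triple_swap.
Qed.
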